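(* Let $q$ be a prime power, $m$ a non-negative integer and let $\mathcal{L}=\langle x^{q^{\ell_1}},\ldots,x^{q^{\ell_s}}\rangle\subset\mathbb{F}_{q^m}[x]$ be the $\mathbb{F}_{q^m}$-linear span of the indicated monomials, where $1\le \ell_1<\ell_2<\cdots<\ell_s<\frac m2$. If $\mathcal{L}$ is an even rank family, then the complete weight enumerator of $\mathcal{C}_{\mathcal{L}}$ is $$W_{\mathcal{C}_{\mathcal{L}}}(z_0,\ldots,z_{q-1})=z_0^{n}+\sum_{i=1}^{2}\sum_{r\in R_{\mathcal{L}}}M_{r,i}\,z_0^{a(r,i)}z_1^{b(r,i)}\cdots z_{q-1}^{b(r,i)},$$ where $n=q^m-1$ and $$a(r,i)=q^{m-1}+(-1)^{i+1}(q-1)q^{m-\frac r2-1}-1,\qquad b(r,i)=q^{m-1}+(-1)^{i}q^{m-\frac r2-1}.$$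
   Context: A function $Q:\mathbb{F}_{q^m}\to\mathbb{F}_q$ is a quadratic form if, after identifying $\mathbb{F}_{q^m}\simeq\mathbb{F}_q^m$ as $\mathbb{F}_q$-spaces, it is given by a homogeneous polynomial of degree 2 in $m$ variables over $\mathbb{F}_q$. Its rank $r$ is the minimum number of variables needed to represent $Q$ (up to invertible linear change of variables); equivalently the codimension of $\{y: Q(y)=0,\ Q(x+y)=Q(x)\ \forall x\in\mathbb{F}_{q^m}\}$. If $r$ is even, then $\#\{x:Q(x)=0\}=q^{m-1}+\varepsilon_Q(q-1)q^{m-\frac r2-1}$ for a unique sign $\varepsilon_Q\in\{\pm1\}$; $Q$ is of type 1 if $\varepsilon_Q=+1$ and of type 3 if $\varepsilon_Q=-1$. $\mathrm{Tr}_{q^m/q}$ is the trace from $\mathbb{F}_{q^m}$ to $\mathbb{F}_q$. For $R\in\mathcal{L}$ put $Q_R(x)=\mathrm{Tr}_{q^m/q}(xR(x))$. $\mathcal{L}$ is an even rank family if $Q_R$ has even rank for every $R\in\mathcal{L}$. For $r\ge 0$ let $M_{r,1}$ (resp. $M_{r,2}$) be the number of $R\in\mathcal{L}\smallsetminus\{0\}$ such that $Q_R$ has rank $r$ and is of type 1 (resp. type 3), and let $R_{\mathcal{L}}=\{r: \exists R\in\mathcal{L}\text{ with }Q_R\text{ of rank }r\}$. The code is $\mathcal{C}_{\mathcal{L}}=\{(\mathrm{Tr}_{q^m/q}(xR(x)))_{x\in\mathbb{F}_{q^m}^*}: R\in\mathcal{L}\}\subset\mathbb{F}_q^{n}$,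 $n=q^m-1$. Order the elements of $\mathbb{F}_q$ as $\omega_0=0,\omega_1,\ldots,\omega_{q-1}$. For $v\in\mathbb{F}_q^n$ let $t_i(v)$ be the number of coordinates of $v$ equal to $\omega_i$. The complete weight enumerator of a linear code $\mathcal{C}\subset\mathbb{F}_q^n$ is $W_{\mathcal{C}}(z_0,\ldots,z_{q-1})=\sum_{c\in\mathcal{C}}z_0^{t_0(c)}z_1^{t_1(c)}\cdots z_{q-1}^{t_{q-1}(c)}$. *)

(* Defs.v *)
From HB Require Import structures.
From mathcomp Require Import all_boot all_order all_algebra all_fingroup all_field.
From mathcomp Require Import finmap.
From mathcomp Require Export mpoly.

Set Implicit Arguments.
Unset Strict Implicit.
Unset Printing Implicit Defensive.

Import GRing.Theory Num.Theory.
Local Open Scope ring_scope.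

(* [finvect_type L] is [L] with its canonical [finFieldType] and
   [splittingFieldType F] structures, so that both finite enumeration and the
   library Galois trace [galTrace] are available on it. *)

(* [galTrace] takes its values in [L]; they lie in the line [F *: 1], which is
   identified with [F] here, so the default [0] is never reached. *)
Definition trace (F : finFieldType) (L : fieldExtType F)
    (x : finvect_type L) : F :=
  odflt 0 [pick c : F | c%:A == galTrace 1%AS {:finvect_type L}%AS x].

(* After the linear change of variables given by some basis [e] of [L] over
   [F], the function [Q] is a homogeneous polynomial of degree 2, with
   coefficients [A i j] (i <= j), which involves only the first [r] variables.
   With [r = \dim {:L}] this says that [Q] is a quadratic form. *)
Definition quad_in (F : finFieldType) (L : fieldExtType F)
    (Q : finvect_type L -> F) (r : nat) : bool :=
  [exists e : (\dim {:finvect_type L}).-tuple (finvect_type L),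
   exists A : 'M[F]_(\dim {:finvect_type L}),
     basis_of {:finvect_type L} e &&
     [forall u : 'rV[F]_(\dim {:finvect_type L}),
        Q (\sum_i u 0 i *: tnth e i) ==
        \sum_(i < \dim {:finvect_type L})
          \sum_(j < \dim {:finvect_type L} | (i <= j < r)%N)
            A i j * u 0 i * u 0 j]].

(* Only meaningful when [Q] is a quadratic form. *)
Definition qrank (F : finFieldType) (L : fieldExtType F)
    (Q : finvect_type L -> F) : nat :=
  [arg min_(r < (ord_max : 'I_(\dim {:finvect_type L}).+1) | quad_in Q r) r].

Definition has_sign (F : finFieldType) (L : fieldExtType F)
    (Q : finvect_type L -> F) (eps : int) : bool :=
  let q := #|F| in let m := \dim {:L} in let r := qrank Q in
  ~~ odd r &&
  (#|[set x | Q x == 0]|%:Z ==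
   q%:Z ^+ m.-1 + eps * (q%:Z - 1) * q%:Z ^+ (m - r./2 - 1)).

Definition type1 (F : finFieldType) (L : fieldExtType F)
  (Q : finvect_type L -> F) : bool := has_sign Q 1.

Definition type3 (F : finFieldType) (L : fieldExtType F)
  (Q : finvect_type L -> F) : bool := has_sign Q (-1).

Definition span_family (F : finFieldType) (L : fieldExtType F)
    (s : nat) (l : 'I_s -> nat) : {fset {poly finvect_type L}} :=
  [fset \sum_(j < s) c j *: 'X^(#|F| ^ l j)
     | c : {ffun 'I_s -> finvect_type L} in predT]%fset.

Definition Qform (F : finFieldType) (L : fieldExtType F)
    (R : {poly finvect_type L}) (x : finvect_type L) : F :=
  trace (x * R.[x]).

Definition even_rank_family (F : finFieldType) (L : fieldExtType F)
    (S : {fset {poly finvect_type L}}) : Prop :=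
  forall R, R \in S -> ~~ odd (qrank (Qform R)).

Definition rank_set (F : finFieldType) (L : fieldExtType F)
    (S : {fset {poly finvect_type L}}) : {fset nat} :=
  [fset qrank (Qform R) | R in S]%fset.

(* Used with [i = 1] (type 1) and [i = 2] (type 3). *)
Definition Mcount (F : finFieldType) (L : fieldExtType F)
    (S : {fset {poly finvect_type L}}) (r i : nat) : nat :=
  #|` [fset R in S | [&& R != 0, qrank (Qform R) == r &
        if i == 1%N then type1 (Qform R) else type3 (Qform R)]]|%fset.

(* Coordinates of the code are indexed by the nonzero elements of [L]. *)
Definition codeword (F : finFieldType) (L : fieldExtType F)
    (R : {poly finvect_type L}) : {ffun {x : finvect_type L | x != 0} -> F} :=
  [ffun x => Qform R (val x)].

Definition code (F : finFieldType) (L : fieldExtType F)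
    (S : {fset {poly finvect_type L}}) :
    {set {ffun {x : finvect_type L | x != 0} -> F}} :=
  [set c in [seq codeword R | R <- S]].

Definition complete_weight_enumerator (F : finFieldType) (I : finType) (q : nat)
    (omega : 'I_q -> F) (C : {set {ffun I -> F}}) : {mpoly int[q]} :=
  \sum_(c in C) \prod_(j < q) 'X_j ^+ #|[set x | c x == omega j]|.

Definition exp_a (q m r i : nat) : int :=
  q%:Z ^+ m.-1 + (-1) ^+ i.+1 * (q%:Z - 1) * q%:Z ^+ (m - r./2 - 1) - 1.

Definition exp_b (q m r i : nat) : int :=
  q%:Z ^+ m.-1 + (-1) ^+ i * q%:Z ^+ (m - r./2 - 1).

(* Main.v *)
Require Import Defs.
From HB Require Import structures.
From mathcomp Require Import all_boot all_order all_algebra all_fingroup all_field.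
From mathcomp Require Import finmap ring zify.

Set Implicit Arguments.
Unset Strict Implicit.
Unset Printing Implicit Defensive.

Import Order.TTheory GRing.Theory Num.Theory.
Local Open Scope ring_scope.

(** The proof has three ingredients.

    Distribution of values.  Let [B] be the polar form of a quadratic form
    [Q] on a space [U] over the field with [q] elements, let [rad] be the
    radical of [B] on [U], and suppose that [Q] vanishes on [rad] and that
    [rad] has codimension [2 * k].  Then [Q] takes all nonzero values equally
    often, and there is a sign [eps] such that, for every [a],
      q * #{Q = a} = |U| + eps * q ^ (dim U - k) * (q - 1 if a = 0, else -1);
    this is [balanced_even].  The proof works in every characteristic and uses
    neither characters nor a classification.  If there is an isotropic [x]
    outside [rad], pass to the hyperplane of vectors of [U] orthogonal to [x]:
    off this hyperplane [Q] is equidistributed, because it is affine and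
    nonconstant on the lines of direction [x], and [k] drops by one
    ([balanced_orthogonal]).  If there is none, then [Q] takes the value 0
    exactly on [rad], and the first two moments of the numbers #{Q = a} are
    known; nonnegativity of the variance over [a != 0] forces [k <= 1], and
    for [k = 1] the variance is 0 ([two_moments]).

    Rank.  The rank of [Q] is the codimension of the space of the vectors of
    [rad] where [Q] vanishes ([qrankE]).  If it is even, this space is the
    whole of [rad] ([even_corank_singular]).  This is clear in odd
    characteristic, where [B x x = 2 Q x]; in characteristic 2 the form [Q] is
    semilinear on [rad], so its kernel there has codimension at most 1, and
    the codimension of the radical of an alternating form is even.

    Injectivity.  If [Tr (x R(x))] vanishes identically, so does its
    polarisation [Tr (y (R(x) + R*(x)))], where [R*] is the adjoint of [R] for
    the trace form; hence [R + R*] vanishes on the whole field.  As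
    [l_j < m / 2 < m - l_j < m], this sum is a polynomial of degree less than
    [q ^ m] whose monomials are pairwise distinct, so that [R = 0].

    Thus the sum over codewords is a sum over [R], the word of a nonzero [R]
    contributes the monomial attached to the rank and the type of [Q_R], and
    grouping equal monomials gives the formula. *)

(** * Integer arithmetic of the first two moments *)

Lemma PoszX (m n : nat) : (m ^ n)%N%:Z = m%:Z ^+ n.
Proof. by rewrite -natz natrX natz. Qed.

Lemma Posz_sum (I : finType) (P : pred I) (f : I -> nat) :
  (\sum_(i | P i) f i)%N%:Z = \sum_(i | P i) (f i)%:Z.
Proof. exact: (big_morph Posz PoszD). Qed.

Lemma sum_sqr_deviation (I : finType) (P : pred I) (f : I -> int) (s : int) :
  \sum_(i | P i) (#|P|%:Z * f i - s) ^+ 2 =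
  #|P|%:Z * (#|P|%:Z * (\sum_(i | P i) f i ^+ 2)
     - 2 * s * (\sum_(i | P i) f i) + s ^+ 2).
Proof.
rewrite (eq_bigr (fun i => (#|P|%:Z ^+ 2 * f i ^+ 2 - (2 * s * #|P|%:Z) * f i) + s ^+ 2)).
  rewrite big_split sumrB /= -!big_distrr /= sumr_const -mulr_natl natz; ring.
by move=> i _; ring.
Qed.

(** In the application, [f i] counts the solutions of [Q x = i] for a form [Q]
    that is anisotropic in [2 * k] variables modulo a radical with [rho]
    elements.  The
    moments give
      q * T = (q - 1) * rho ^ 2 * (q ^ (2 k) - 1) * (q ^ 2 - q ^ (2 k)),
    where [T] is the sum over [i != i0] of the squared deviations of
    [(q - 1) * f i] from its mean [rho * (q ^ (2 k) - 1)].  The left side is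
    nonnegative, so [k = 1], and then [T = 0]. *)
Lemma two_moments (I : finType) (i0 : I) (f : I -> nat) (rho k : nat) :
    let q := #|I| in
    (1 < q)%N -> (0 < rho)%N -> (0 < k)%N -> f i0 = rho ->
    (\sum_i f i = rho * q ^ k.*2)%N ->
    (q * (\sum_i f i ^ 2) + rho * (rho * q ^ k.*2) =
      (rho * q ^ k.*2) * (rho * q ^ k.*2) + q * rho * (rho * q ^ k.*2))%N ->
  k = 1%N /\ forall i, i != i0 -> f i = (rho * q.+1)%N.
Proof.
move=> q q1 rho0 k0 f0; rewrite !(bigD1 i0 (P := predT)) //= f0.
move/(congr1 Posz); rewrite PoszM PoszD Posz_sum => S1.
move/(congr1 Posz); rewrite !(PoszM, PoszD) Posz_sum => S2.
have cardP : #|predC1 i0|%:Z = q%:Z - 1.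
  by have := cardC1 i0; rewrite /q; move: q1; rewrite /q; case: #|I| => // n _ ->; lia.
rewrite PoszX in S1 S2; set P := q%:Z ^+ k.*2 in S1 S2.
rewrite (eq_bigr (fun i => (f i)%:Z ^+ 2)) in S2; last by move=> i _; exact: PoszX.
set A := \sum_(i | _) _ in S1; set A2 := \sum_(i | _) _ in S2.
have {S1} AE : A = rho%:Z * (P - 1) by rewrite mulrBr mulr1 -S1; ring.
have := sum_sqr_deviation (predC1 i0) (fun i => (f i)%:Z) (rho%:Z * (P - 1)).
rewrite cardP -/A -/A2 AE; set T := \sum_(i | _) _ => TE.
have qT : q%:Z * T = (q%:Z - 1) * rho%:Z ^+ 2 * (P - 1) * (q%:Z ^+ 2 - P).
  have qA2 : q%:Z * A2 = rho%:Z ^+ 2 * (P - 1) * (P + q%:Z).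
    by apply/eqP; rewrite -subr_eq0; apply/eqP; move/eqP: S2; rewrite -subr_eq0 => /eqP <-; ring.
  transitivity ((q%:Z - 1) * ((q%:Z - 1) * (q%:Z * A2) - q%:Z * rho%:Z ^+ 2 * (P - 1) ^+ 2)).
    by rewrite TE; ring.
  by rewrite qA2; ring.
have P1 : 1 < P by rewrite exprn_egt1 // double_eq0 -lt0n.
have T0 : 0 <= T by apply: sumr_ge0 => i _; exact: sqr_ge0.
have Pq : P <= q%:Z ^+ 2.
  have : 0 <= q%:Z * T by rewrite mulr_ge0.
  rewrite qT pmulr_rge0 ?subr_ge0 // !mulr_gt0 ?exprn_gt0 ?subr_gt0 //.
have k1 : k = 1%N.
  move: Pq; rewrite ler_eXn2l //; lia.
split=> // i ni0.
have PE : P = q%:Z ^+ 2 by rewrite /P k1.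
move: qT; rewrite PE subrr mulr0 => /eqP; rewrite mulf_eq0 => /orP[|]; first by lia.
rewrite psumr_eq0 => [/allP/(_ i (mem_index_enum i))|j _]; last exact: sqr_ge0.
rewrite /= ni0 /= sqrf_eq0 subr_eq0 => /eqP E.
have qn0 : q%:Z - 1 != 0 by lia.
apply/eqP; rewrite -eqz_nat -(inj_eq (mulfI qn0)) E PE PoszM -[q.+1]addn1 PoszD; apply/eqP; ring.
Qed.

(** * Quadratic forms and their radicals *)

Section QuadraticForms.

Variables (F : finFieldType) (vT : vectType F).
Local Notation V := (finvect_type vT).
Implicit Types (Q : V -> F) (U : {vspace V}) (x y z u v : V) (a b c : F).

(** A subset of a finite space that is closed under linear combinations is a
    subspace, namely its own span; this turns radicals and orthogonals, which
    are given by predicates, into elements of [{vspace V}]. *)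
Lemma mem_span_enum (P : pred V) :
    P 0 -> (forall a u v, P u -> P v -> P (a *: u + v)) ->
  forall v, (v \in <<enum P>>%VS) = P v.
Proof.
move=> P0 Plin v; apply/idP/idP => [|Pv]; last by rewrite memv_span ?mem_enum.
have -> : enum P = in_tuple (enum P) by [].
move/coord_span->.
apply: (big_ind P) => // [x y Px Py|i _]; first by rewrite -[x]scale1r Plin.
rewrite -[X in P X]addr0 Plin //.
have: (enum P)`_i \in enum P by rewrite mem_nth.
by rewrite mem_enum.
Qed.

Definition polar Q x y := Q (x + y) - Q x - Q y.

Definition quadratic_form Q :=
  (forall a x, Q (a *: x) = a ^+ 2 * Q x) /\
  (forall z a x y, polar Q (a *: x + y) z = a * polar Q x z + polar Q y z).

Definition radical Q U : {vspace V} :=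
  <<enum [pred y | (y \in U) && [forall u in U, polar Q y u == 0%R]]>>%VS.

Definition orthogonal Q U x : {vspace V} :=
  <<enum [pred y | (y \in U) && (polar Q y x == 0%R)]>>%VS.

(** On each line of direction [x] inside [D] the function [f] is affine with
    slope [g u != 0], so it takes the value [a] exactly once there. *)
Lemma card_line_fiber (D : pred V) (f g : V -> F) x a :
    (forall c u, D u -> D (u + c *: x)) ->
    (forall c u, D u -> f (u + c *: x) = f u + c * g u) ->
    (forall u, D u -> g u != 0) ->
  (#|F| * #|[pred u | D u && (f u == a)]| = #|D|)%N.
Proof.
move=> Dx fx g0.
have ->: (#|F| * #|[pred u | D u && (f u == a)]| =
         \sum_(c : F) \sum_(u | D u) (f (u + c *: x)%R == a))%N.
  rewrite -sum_nat_const; apply: eq_bigr => c _.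
  rewrite -sum1_card (reindex_inj (addIr (c *: x))) /=.
  rewrite big_mkcond [RHS]big_mkcond; apply: eq_bigr => u _ /=.
  rewrite inE; have -> : D (u + c *: x) = D u.
    apply/idP/idP; last exact: Dx.
    by move/(Dx (- c)); rewrite scaleNr addrK.
  by case: (D u) => //=; case: eqP.
rewrite exchange_big -sum1_card; apply: eq_bigr => u Du.
rewrite (bigD1 ((a - f u) / g u)) //= fx // divfK ?g0 // addrC subrK eqxx.
rewrite big1 // => c /eqP nc; rewrite fx //; case: eqP => // E.
by case: nc; rewrite -E addrAC subrr add0r mulfK ?g0.
Qed.

Section Form.

Variable Q : V -> F.
Hypothesis Qquad : quadratic_form Q.
Local Notation B := (polar Q).

Lemma quadZ a x : Q (a *: x) = a ^+ 2 * Q x.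
Proof. exact: Qquad.1. Qed.

Lemma quad0 : Q 0 = 0.
Proof. by rewrite -(scale0r 0) quadZ expr0n mul0r. Qed.

Lemma quadD x y : Q (x + y) = Q x + Q y + B x y.
Proof. by rewrite /polar; ring. Qed.

Lemma polarC x y : B x y = B y x.
Proof. by rewrite /polar [x + y]addrC addrAC. Qed.

Lemma polarPl z a x y : B (a *: x + y) z = a * B x z + B y z.
Proof. exact: Qquad.2. Qed.

Lemma polarDl z x y : B (x + y) z = B x z + B y z.
Proof. by rewrite -[x]scale1r polarPl mul1r scale1r. Qed.

Lemma polar0l z : B 0 z = 0.
Proof. by apply: (addrI (B 0 z)); rewrite -polarDl !addr0. Qed.

Lemma polarZl z a x : B (a *: x) z = a * B x z.
Proof. by rewrite -[a *: x]addr0 polarPl polar0l addr0. Qed.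

Lemma polarDr z x y : B z (x + y) = B z x + B z y.
Proof. by rewrite polarC polarDl !(polarC z). Qed.

Lemma polarZr z a x : B z (a *: x) = a * B z x.
Proof. by rewrite polarC polarZl (polarC z). Qed.

Lemma polarxx x : B x x = Q x *+ 2.
Proof. by rewrite /polar -mulr2n -scaler_nat quadZ; ring. Qed.

Lemma mem_radical U y :
  (y \in radical Q U) = (y \in U) && [forall u in U, B y u == 0].
Proof.
rewrite mem_span_enum //= => [|a u v /andP[Uu /forall_inP Bu] /andP[Uv /forall_inP Bv]].
  by rewrite mem0v; apply/forall_inP => u _; rewrite polar0l.
rewrite memvD ?memvZ //; apply/forall_inP => w Uw.
by rewrite polarPl (eqP (Bu w Uw)) (eqP (Bv w Uw)) mulr0 addr0.
Qed.

Lemma radicalP U y :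
  reflect (y \in U /\ forall u, u \in U -> B y u = 0) (y \in radical Q U).
Proof.
rewrite mem_radical; apply: (iffP andP) => -[Uy H]; split=> //.
  by move=> u Uu; apply/eqP/(forall_inP H).
by apply/forall_inP => u Uu; rewrite H.
Qed.

Lemma mem_orthogonal U x y : (y \in orthogonal Q U x) = (y \in U) && (B y x == 0).
Proof.
rewrite mem_span_enum //= => [|a u v /andP[Uu /eqP Bu] /andP[Uv /eqP Bv]].
  by rewrite mem0v polar0l eqxx.
by rewrite memvD ?memvZ // polarPl Bu Bv mulr0 addr0 eqxx.
Qed.

Lemma radical_sub U : (radical Q U <= U)%VS.
Proof. by apply/subvP => y /radicalP[]. Qed.

Lemma radicalNP U x : x \in U -> x \notin radical Q U ->
  exists2 y, y \in U & B x y = 1.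
Proof.
move=> Ux; rewrite mem_radical Ux /= => /forall_inPn[y Uy Bxy].
exists ((B x y)^-1 *: y); first exact: memvZ.
by rewrite polarZr mulVf.
Qed.

Lemma card_polar_fiber U x a : x \in U -> x \notin radical Q U ->
  (#|F| * #|[pred u | (u \in U) && (B u x == a)]| = #|U|)%N.
Proof.
move=> Ux /(radicalNP Ux)[y Uy Bxy].
apply: (@card_line_fiber (mem U) (B^~ x) (fun=> 1) y).
- by move=> c u Uu; exact: memvD (memvZ _ Uy).
- by move=> c u Uu /=; rewrite polarDl polarZl [B y x]polarC Bxy.
- by move=> *; exact: oner_neq0.
Qed.

Lemma dim_orthogonal U x : x \in U -> x \notin radical Q U ->
  \dim U = (\dim (orthogonal Q U x)).+1.
Proof.
move=> Ux Rx; apply: (@expnI #|F|); first exact: finNzRing_gt1.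
rewrite -card_vspace -(card_polar_fiber 0 Ux Rx) expnS -card_vspace.
by congr (_ * _)%N; apply: eq_card => y; rewrite [RHS]mem_orthogonal.
Qed.

(** If [y] satisfies [B x y = 1] and [z] is in the radical of
    the orthogonal of [x], then
    [B z] and [B z y * B x] agree on [U]: they agree at [y], and both vanish on
    the orthogonal of [x].  So [z - B z y *: x] is in the radical of [U]. *)
Lemma radical_orthogonal U x : x \in U -> x \notin radical Q U -> B x x = 0 ->
  radical Q (orthogonal Q U x) = (radical Q U + <[x]>)%VS.
Proof.
move=> Ux Rx Bxx; have [y Uy Bxy] := radicalNP Ux Rx.
apply/vspaceP => z; apply/idP/memv_addP => [|[r Rr [_ /vlineP[c ->] ->]]].
  case/radicalP; rewrite mem_orthogonal => /andP[Uz /eqP Bzx] Bz.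
  exists (z - B z y *: x); last first.
    by exists (B z y *: x); rewrite ?subrK // memvZ ?memv_line.
  apply/radicalP; split=> [|u Uu]; first by rewrite memvB ?memvZ.
  rewrite -scaleNr polarDl polarZl.
  have /Bz: u - B u x *: y \in orthogonal Q U x.
    rewrite mem_orthogonal memvB ?memvZ //= -scaleNr polarDl polarZl.
    by rewrite [B y x]polarC Bxy mulr1 subrr.
  by rewrite -scaleNr polarDr polarZr (polarC u x) => <-; ring.
have [Ur Br] := radicalP _ _ Rr; apply/radicalP; split=> [|u].
  by rewrite mem_orthogonal memvD ?memvZ //= polarDl polarZl Br // Bxx mulr0 addr0.
rewrite mem_orthogonal => /andP[Uu /eqP Bux].
by rewrite polarDl polarZl Br // [B x u]polarC Bux mulr0 addr0.
Qed.

Lemma dim_radical_orthogonal U x : x \in U -> x \notin radical Q U -> B x x = 0 ->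
  \dim (radical Q (orthogonal Q U x)) = (\dim (radical Q U)).+1.
Proof.
move=> Ux Rx Bxx; rewrite radical_orthogonal // dimv_disjoint_sum.
  have -> : \dim <[x]> = 1%N; last by rewrite addn1.
  by rewrite dim_vline; case: eqP => // x0; rewrite x0 mem0v in Rx.
apply/eqP; rewrite -subv0; apply/subvP => z /memv_capP[Rz /vlineP[c Ez]].
move: Rz; rewrite {}Ez; case: (eqVneq c 0) => [-> _|c0]; first by rewrite scale0r mem0v.
by move/(memvZ c^-1); rewrite scalerA mulVf // scale1r (negPf Rx).
Qed.

(** The vectors of [U] orthogonal to a nonradical [x] form a space of
    dimension one less, whose radical has dimension one more: the codimension
    of the radical drops by 2. *)
Lemma alternating_codim_radical U : (forall x, B x x = 0) ->
  ~~ odd (\dim U - \dim (radical Q U)).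
Proof.
move=> Balt; have [n] := ubnP (\dim U); elim: n U => // n IHn U le_n.
have [/subvP RU|/subvPn[x Ux Rx]] := boolP (U <= radical Q U)%VS.
  by rewrite (_ : radical Q U = U) ?subnn //; apply/eqP; rewrite eqEsubv radical_sub; apply/subvP.
have := IHn (orthogonal Q U x).
have := dim_radical_orthogonal Ux Rx (Balt x).
have := dim_orthogonal Ux Rx.
have := dimvS (radical_sub (orthogonal Q U x)).
move: le_n => /=; lia.
Qed.

(** * Distribution of the values of a quadratic form *)

Definition value_count U a := #|[pred u | (u \in U) && (Q u == a)]|.
Local Notation N := value_count.

Lemma sum_value_count U : (\sum_a N U a)%N = #|U|.
Proof.
rewrite -sum1_card (partition_big Q predT) //=.
by apply: eq_bigr => a _; rewrite sum1_card.
Qed.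

(** The condition says that [B y u = - Q u], which is one affine condition on
    [y] unless [u] is radical. *)
Lemma card_level_difference U u : u \in U -> {in radical Q U, forall x, Q x = 0} ->
  (#|F| * #|[pred y | (y \in U) && (Q (u + y)%R == Q y)]| =
   if u \in radical Q U then #|F| * #|U| else #|U|)%N.
Proof.
move=> Uu Q0; have QE y : (Q (u + y) == Q y) = (B y u == - Q u).
  by rewrite quadD polarC -subr_eq0 -[RHS]subr_eq0; congr (_ == 0); ring.
rewrite (eq_card (B := [pred y | (y \in U) && (B y u == - Q u)%R])); last first.
  by move=> y; rewrite !inE QE.
case: ifPn => [Ru|/card_polar_fiber-> //].
congr (_ * _)%N; apply: eq_card => y; rewrite inE Q0 // oppr0.
case Uy: (y \in U) => //=; have [_ Bu] := radicalP _ _ Ru.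
by rewrite polarC Bu // eqxx.
Qed.

(** The sum of the squares counts the pairs [(x, y)] with [Q x = Q y]; put
    [x = u + y] and count the [y] for each [u]. *)
Lemma sum_value_count_sqr U : {in radical Q U, forall x, Q x = 0} ->
  (#|F| * (\sum_a N U a ^ 2) + #|radical Q U| * #|U| =
   #|U| * #|U| + #|F| * #|radical Q U| * #|U|)%N.
Proof.
move=> Q0.
have -> : (\sum_a N U a ^ 2 =
    \sum_(u in U) #|[pred y | (y \in U) && (Q (u + y)%R == Q y)]|)%N.
  transitivity (\sum_(y in U) N U (Q y))%N.
    rewrite [RHS](partition_big Q predT) //=; apply: eq_bigr => a _.
    rewrite (eq_bigr (fun=> N U a)) => [|y /andP[_ /eqP-> //]].
    by rewrite sum_nat_const mulnn.
  under eq_bigr => y Uy do rewrite /value_count -sum1_card.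
  under [RHS]eq_bigr => y Uy do rewrite -sum1_card.
  rewrite [RHS](exchange_big_dep (mem U)) /=; last by move=> i j _ /andP[].
  apply: eq_bigr => y Uy; rewrite (reindex_inj (addIr y)) /=.
  by apply: eq_bigl => u; rewrite !inE Uy /= rpredDr.
rewrite big_distrr /= (eq_bigr _ (fun u Uu => card_level_difference Uu Q0)).
have /subvP RU := radical_sub U.
have E : (#|fun u => (u \in U) && (u \notin radical Q U)| + #|radical Q U| = #|U|)%N.
  rewrite -(cardID (mem (radical Q U)) (mem U)) addnC; congr (_ + _)%N.
    by apply: eq_card => u; rewrite !inE; case Ru: (u \in radical Q U); rewrite ?andbF //= RU.
  by apply: eq_card => u; exact: andbC.
rewrite (bigID (mem (radical Q U))) /=.
rewrite (eq_bigr (fun=> #|F| * #|U|)%N) => [|u /andP[_ ->] //].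
rewrite [X in (_ + X + _)%N](eq_bigr (fun=> #|U|)) => [|u /andP[_ /negPf->] //].
rewrite !sum_nat_const (_ : #|_| = #|radical Q U|); last first.
  by apply: eq_card => u; rewrite unfold_in; apply: andb_idl => /RU.
by rewrite -[X in _ = (X * _ + _)%N]E; ring.
Qed.

(** The value distribution of an even-dimensional nondegenerate form, with the
    equation multiplied by the order of the field so that the exponent of the
    deviation is never negative. *)
Definition balanced U (eps : int) (k : nat) := forall a,
  #|F|%:Z * (N U a)%:Z = #|U|%:Z
    + eps * #|F|%:Z ^+ (\dim U - k) * (if a == 0 then #|F|%:Z - 1 else -1).

Lemma value_count0_anisotropic U : {in radical Q U, forall x, Q x = 0} ->
    {in U, forall x, Q x = 0 -> x \in radical Q U} ->
  N U 0 = #|radical Q U|.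
Proof.
move=> Q0 Qan; apply: eq_card => x; rewrite inE; apply/andP/idP => [[Ux /eqP]|Rx].
  exact: Qan.
by rewrite Q0 // (subvP (radical_sub U)).
Qed.

(** Here [k] is 0, with sign [1], or 1, with sign [-1]: in the plane, [Q] is
    a multiple of the norm form of the quadratic extension. *)
Lemma balanced_anisotropic U k : {in radical Q U, forall x, Q x = 0} ->
    {in U, forall x, Q x = 0 -> x \in radical Q U} ->
    \dim U = (\dim (radical Q U) + k.*2)%N ->
  exists2 eps : int, (eps == 1) || (eps == -1) & balanced U eps k.
Proof.
move=> Q0 Qan dimU; have N0 := value_count0_anisotropic Q0 Qan.
have q1 : (1 < #|F|)%N := finNzRing_gt1 F.
have cardU : #|U| = (#|radical Q U| * #|F| ^ k.*2)%N.
  by rewrite !card_vspace dimU expnD.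
have rho0 : (0 < #|radical Q U|)%N by rewrite card_vspace expn_gt0 ltnW.
have [k0|k0] := posnP k.
  have RU : radical Q U = U by apply/eqP; rewrite eqEdim radical_sub dimU k0 addn0 leqnn.
  exists 1 => // a; rewrite k0 subn0 mul1r card_vspace PoszX.
  have [->|a0] := eqVneq a 0; first by rewrite N0 RU card_vspace PoszX; ring.
  have -> : N U a = 0%N; last by rewrite mulrN1 subrr mulr0.
  apply: eq_card0 => x; rewrite !inE; apply/negbTE/negP => /andP[Ux].
  by rewrite Q0 ?RU // eq_sym (negPf a0).
have := sum_value_count U; have := sum_value_count_sqr Q0.
rewrite cardU => S2 S1.
have [k1 NE] := two_moments q1 rho0 k0 N0 S1 S2.
exists (-1); first by rewrite eqxx orbT.
move=> a; rewrite dimU cardU k1 (_ : _ + 1.*2 - 1 = (\dim (radical Q U)).+1)%N; last by lia.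
have rhoE : #|F|%:Z ^+ \dim (radical Q U) = #|radical Q U| by rewrite card_vspace PoszX.
rewrite PoszM PoszX [_ ^+ _.+1]exprS rhoE.
have [->|a0] := eqVneq a 0; first by rewrite N0; ring.
by rewrite NE // PoszM -[(#|F|).+1]addn1 PoszD; ring.
Qed.

(** Off the orthogonal of [x], where [Q (u + c *: x) = Q u + c * B u x] with
    [B u x != 0], each value is taken equally often. *)
Lemma orthogonal_value_count U x a : x \in U -> x \notin radical Q U -> Q x = 0 ->
  (#|F| ^ 2 * N U a + #|U| = #|F| ^ 2 * N (orthogonal Q U x) a + #|F| * #|U|)%N.
Proof.
move=> Ux Rx Qx; have Bxx : B x x = 0 by rewrite polarxx Qx mul0rn.
set D := [pred u | (u \in U) && (B u x != 0)].
have cD : (#|F| * #|[pred u | D u && (Q u == a)]| = #|D|)%N.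
  apply: (card_line_fiber (x := x) (g := B^~ x)) => [c u|c u _|u] /=.
  - by case/andP=> Uu Bux; rewrite memvD ?memvZ //= polarDl polarZl Bxx mulr0 addr0.
  - by rewrite quadD quadZ Qx polarZr; ring.
  - by case/andP.
have cO : (#|F| * #|orthogonal Q U x| = #|U|)%N.
  by rewrite !card_vspace -expnS -dim_orthogonal.
have cU : (#|orthogonal Q U x| + #|D| = #|U|)%N.
  rewrite -(cardID (mem (orthogonal Q U x)) (mem U)); congr (_ + _)%N.
    by apply: eq_card => u; rewrite !inE mem_orthogonal; case: (u \in U).
  by apply: eq_card => u; rewrite !inE mem_orthogonal; case: (u \in U); rewrite ?andbT ?andbF.
have cN : (N U a = N (orthogonal Q U x) a + #|[pred u | D u && (Q u == a)]|)%N.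
  rewrite /value_count -(cardID (mem (orthogonal Q U x)) [pred u | (u \in U) && (Q u == a)]).
  congr (_ + _)%N; apply: eq_card => u; rewrite !inE mem_orthogonal;
    by case: (u \in U); rewrite ?andbT ?andbF //= andbC.
have qU : (#|F| * #|D| + #|U| = #|F| * #|U|)%N.
  by rewrite -[in RHS]cU mulnDr cO addnC.
by rewrite cN mulnDr -[X in (_ + X + _)%N]mulnA cD -qU addnA.
Qed.

Lemma balanced_orthogonal U x eps k : x \in U -> x \notin radical Q U -> Q x = 0 ->
  (k <= \dim (orthogonal Q U x))%N ->
  balanced (orthogonal Q U x) eps k -> balanced U eps k.+1.
Proof.
move=> Ux Rx Qx lek bal a.
have dU := dim_orthogonal Ux Rx.
have cU : #|U|%:Z = #|F|%:Z * #|orthogonal Q U x|%:Z.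
  by rewrite !card_vspace dU expnS PoszM.
have q0 : #|F|%:Z != 0 by rewrite eqz_nat -lt0n ltnW ?finNzRing_gt1.
have := orthogonal_value_count a Ux Rx Qx; move/(congr1 Posz).
rewrite -mulnn !PoszD !PoszM cU dU subSS; move: (bal a) q0.
set e := eps * _ * _; move: e (Posz (N _ _)) (Posz (N _ _)) (Posz #|orthogonal Q U x|) (Posz #|F|).
move=> e Nu No O q balE q0 E; apply: (mulfI q0).
have -> : q * (q * Nu) = q * (q * No) + q * (q * O) - q * O.
  by rewrite -[LHS](addrK (q * O)) 2!mulrA E; ring.
by rewrite balE; ring.
Qed.

(** Induction on [k], splitting off isotropic vectors until the form is
    anisotropic modulo its radical. *)
Lemma balanced_even U k : {in radical Q U, forall x, Q x = 0} ->
    \dim U = (\dim (radical Q U) + k.*2)%N ->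
  exists2 eps : int, (eps == 1) || (eps == -1) & balanced U eps k.
Proof.
have [n] := ubnP k; elim: n U k => // n IHn U k lekn Q0 dimU.
have [/forall_inP Qan|/forall_inPn[x Ux]] :=
    boolP [forall x in U, (Q x == 0) ==> (x \in radical Q U)].
  apply: balanced_anisotropic => // x Ux Qx.
  by have /implyP := Qan x Ux; apply; apply/eqP.
rewrite negb_imply => /andP[/eqP Qx Rx].
have Bxx : B x x = 0 by rewrite polarxx Qx mul0rn.
have dU := dim_orthogonal Ux Rx; have dR := dim_radical_orthogonal Ux Rx Bxx.
have le_R := dimvS (radical_sub (orthogonal Q U x)).
case: k => [|k] in lekn dimU *; first by lia.
have [] := IHn (orthogonal Q U x) k; [by lia | | by lia |].
  move=> y; rewrite radical_orthogonal // => /memv_addP[r Rr [_ /vlineP[c ->] ->]].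
  by rewrite quadD quadZ Qx polarZr Q0 // (radicalP _ _ Rr).2 ?mulr0 ?addr0.
move=> eps Heps bal; exists eps => //; apply: (balanced_orthogonal Ux Rx Qx) => //.
by lia.
Qed.

(** * The rank as the codimension of the singular radical *)

(** The space of the [y] such that [Q (x + y) = Q x] for all [x]. *)
Definition singular_radical : {vspace V} :=
  <<enum [pred y | (y \in radical Q fullv) && (Q y == 0%R)]>>%VS.

Lemma mem_singular_radical y :
  (y \in singular_radical) = (y \in radical Q fullv) && (Q y == 0).
Proof.
rewrite mem_span_enum //= => [|a u v /andP[Ru /eqP Qu] /andP[Rv /eqP Qv]].
  by rewrite mem0v quad0 eqxx.
rewrite memvD ?memvZ //= quadD quadZ Qu Qv polarZl.
by rewrite (radicalP _ _ Ru).2 ?memvf // !mulr0 !addr0 eqxx.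
Qed.

Lemma singular_radical_sub : (singular_radical <= radical Q fullv)%VS.
Proof. by apply/subvP => y; rewrite mem_singular_radical => /andP[]. Qed.

Lemma invariant_singular y : (forall x, Q (x + y) = Q x) -> y \in singular_radical.
Proof.
move=> Qy; have Qy0 : Q y = 0 by rewrite -[y]add0r Qy quad0.
rewrite mem_singular_radical Qy0 eqxx andbT; apply/radicalP; split=> [|u _].
  exact: memvf.
by rewrite /polar addrC [y + u]addrC Qy Qy0 subr0 addNr.
Qed.

Lemma quad_expand n (e : nat -> V) (u : nat -> F) :
  Q (\sum_(i < n) u i *: e i) =
  \sum_(i < n) \sum_(j < n | (i <= j)%N)
    (if i == j then Q (e i) else B (e i) (e j)) * u i * u j.
Proof.
have polar_sum m z : B (\sum_(i < m) u i *: e i) z = \sum_(i < m) u i * B (e i) z.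
  by elim: m => [|m IHm]; rewrite ?big_ord0 ?polar0l // !big_ord_recr polarDl polarZl IHm.
elim: n => [|n IHn]; first by rewrite !big_ord0 quad0.
rewrite !big_ord_recr /= quadD IHn quadZ.
have -> : \sum_(j < n.+1 | (n <= j)%N)
    (if ord_max == j then Q (e n) else B (e n) (e j)) * u n * u j = u n ^+ 2 * Q (e n).
  rewrite (big_pred1 ord_max) /= ?eqxx => [|j]; first by ring.
  by rewrite [RHS]/= -val_eqE /= eqn_leq leq_ord.
rewrite addrAC; congr (_ + _).
rewrite polarC polarZl polarC polar_sum big_distrr -big_split /=.
apply: eq_bigr => i _; rewrite [RHS]big_mkcond big_ord_recr -big_mkcond /=.
rewrite ltnW //= -val_eqE /= ltn_eqF //; congr (_ + _); last by ring.
Qed.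

Lemma sqr_surjective_char2 a : 2%:R = 0 :> F -> exists c, c ^+ 2 = a.
Proof.
move=> two0; have sqr_inj : injective (fun c : F => c ^+ 2).
  move=> c d /eqP; rewrite -subr_eq0 => /eqP cd; apply/eqP; rewrite -subr_eq0 -sqrf_eq0.
  apply/eqP; rewrite -cd sqrrB -mulr_natl two0 mul0r subr0 -[RHS]addr0.
  by rewrite -(mul0r (d ^+ 2)) -two0; ring.
by exists (invF sqr_inj a); rewrite -[RHS](f_invF sqr_inj).
Qed.

(** A nonsingular vector [y] of the radical forces characteristic 2, because
    [B y y = 2 Q y].  Then [Q] is additive on the radical, and
    [Q (c *: y) = c ^ 2 * Q y] takes every value, so [singular_radical] is a
    hyperplane of the radical; but the radical has even codimension, as [B] is
    alternating. *)
Lemma even_corank_singular : ~~ odd (\dim {:V} - \dim singular_radical) ->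
  {in radical Q fullv, forall y, Q y = 0}.
Proof.
move=> even_corank y Ry; apply/eqP/negPn/negP => Qy0.
have two0 : 2%:R = 0 :> F.
  apply: (mulIf Qy0); rewrite mul0r mulr_natl -polarxx.
  by case/radicalP: (Ry) => _ ->; rewrite ?memvf.
have Balt x : B x x = 0 by rewrite polarxx -mulr_natl two0 mul0r.
have := alternating_codim_radical fullv Balt.
have radE : radical Q fullv = (singular_radical + <[y]>)%VS.
  apply/eqP; rewrite eqEsubv subv_add singular_radical_sub -memvE Ry !andbT.
  apply/subvP => z Rz; have [c cE] := sqr_surjective_char2 (Q z / Q y) two0.
  apply/memv_addP; exists (z - c *: y); last first.
    by exists (c *: y); rewrite ?subrK // memvZ ?memv_line.
  rewrite mem_singular_radical memvB ?memvZ //= -scaleNr quadD quadZ sqrrN cE.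
  rewrite divfK // polarZr (radicalP _ _ Rz).2 ?memvf // mulr0 addr0.
  by rewrite -mulr2n -mulr_natl two0 mul0r.
have dimR : \dim (radical Q fullv) = (\dim singular_radical).+1.
  rewrite radE dimv_disjoint_sum.
    rewrite dim_vline; case: eqP => [y0|_]; last by rewrite addn1.
    by rewrite y0 quad0 eqxx in Qy0.
  apply/eqP; rewrite -subv0; apply/subvP => z /memv_capP[Sz /vlineP[c zE]].
  move: Sz; rewrite zE mem_singular_radical quadZ mulf_eq0 (negPf Qy0) orbF sqrf_eq0.
  by case/andP=> _ /eqP->; rewrite scale0r mem0v.
have := dimvS (subvf (radical Q fullv)); move: even_corank; rewrite dimR.
move: (\dim _) (\dim _) => d n; lia.
Qed.
End Form.
End QuadraticForms.

Section Rank.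

Variables (F : finFieldType) (L : fieldExtType F).
Local Notation V := (finvect_type L).
Variable Q : V -> F.
Hypothesis Qquad : quadratic_form Q.
Local Notation n := (\dim {:V}).

(** In a basis where only the first [r] coordinates matter, adding one of the
    other basis vectors does not change the value of [Q], so those vectors lie
    in the singular radical. *)
Lemma quad_in_corank r : quad_in Q r -> (n <= \dim (singular_radical Q) + r)%N.
Proof.
case/existsP => e /existsP[A /andP[be /forallP QE]].
have SE i : (r <= i)%N -> e`_i \in singular_radical Q.
  move=> le_ri; case: (ltnP i n) => [lt_in|le_ni]; last first.
    by rewrite nth_default ?mem0v // size_tuple.
  apply: invariant_singular => // x; set k := Ordinal lt_in.
  have xE : x = \sum_j (\row_j coord e j x) 0 j *: tnth e j.
    rewrite {1}(coord_basis be (memvf x)); apply: eq_bigr => j _.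
    by rewrite mxE (tnth_nth 0).
  have -> : x + e`_i = \sum_j (\row_j coord e j x + delta_mx 0 k) 0 j *: tnth e j.
    under eq_bigr do rewrite mxE scalerDl.
    rewrite big_split /= -xE (bigD1 k) //= [delta_mx _ _ _ _]mxE !eqxx scale1r (tnth_nth 0).
    rewrite [X in _ + (_ + X)]big1 ?addr0 // => j njk.
    by rewrite mxE (negPf njk) andbF scale0r.
  rewrite {2}xE (eqP (QE _)) (eqP (QE _)); apply: eq_bigr => a _; apply: eq_bigr => b /andP[ab br].
  have nk (j : 'I_n) : (j < r)%N -> (\row_j coord e j x + delta_mx 0 k) 0 j = (\row_j coord e j x) 0 j.
    move=> jr; have njk : j != k by rewrite neq_ltn /= (leq_trans jr).
    by rewrite [LHS]mxE [delta_mx _ _ _ _]mxE (negPf njk) andbF addr0.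
  by rewrite !nk // (leq_ltn_trans ab br).
have /dimvS : (<<drop r e>> <= singular_radical Q)%VS.
  apply/span_subvP => y /(nthP 0)[i lt_i <-].
  by rewrite nth_drop SE ?leq_addr.
have := basis_free be; rewrite -{1}(cat_take_drop r e) => /catr_free/eqP->.
by rewrite size_drop size_tuple leq_subLR addnC.
Qed.

(** Take a basis of a complement of the singular radical followed by a basis
    of the singular radical: the coordinates of the latter do not occur. *)
Lemma quad_in_ge r : (n <= \dim (singular_radical Q) + r)%N -> quad_in Q r.
Proof.
set S := singular_radical Q => le_nr.
pose s : seq V := vbasis S^C ++ vbasis S.
have size_s : size s == n.
  by rewrite size_cat !size_tuple dimv_compl subnK // dimvS // subvf.
have bs : basis_of {:V} (Tuple size_s).
  rewrite basisEdim span_cat !(span_basis (vbasisP _)) addvC addv_complf subvv.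
  by rewrite (eqP size_s) leqnn.
have SE (j : 'I_n) : (r <= j)%N -> s`_j \in S.
  move=> le_rj; have le_SC : (\dim S^C <= r)%N by rewrite dimv_compl leq_subLR.
  have lt_jn : (j < \dim S^C + \dim S)%N by rewrite dimv_compl subnK ?dimvS ?subvf.
  rewrite nth_cat size_tuple ifN ?vbasis_mem ?mem_nth ?size_tuple //; last by lia.
  by rewrite ltn_subLR //; lia.
apply/existsP; exists (Tuple size_s); apply/existsP.
exists (\matrix_(i, j) if i == j then Q s`_i else polar Q s`_i s`_j).
rewrite bs; apply/forallP => u; apply/eqP.
(* [quad_expand] wants vectors indexed by [nat]; the default 0 is never reached. *)
pose u' i := oapp (u 0) 0 (insub i).
have uE (i : 'I_n) : u' i = u 0 i by rewrite /u' valK.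
have -> : \sum_i u 0 i *: tnth (Tuple size_s) i = \sum_(i < n) u' i *: s`_i.
  by apply: eq_bigr => i _; rewrite uE (tnth_nth 0).
rewrite (quad_expand Qquad); apply: eq_bigr => i _.
rewrite (bigID (fun j : 'I_n => j < r)%N) /= [X in _ + X]big1 ?addr0 => [|j].
  by apply: eq_bigr => j _; rewrite mxE !uE.
rewrite -leqNgt => /andP[_ /SE]; rewrite mem_singular_radical // => /andP[Rj /eqP Qj].
case: eqP => [->|_]; first by rewrite Qj !mul0r.
by rewrite polarC ((radicalP Qquad _ _ Rj).2 _ (memvf _)) !mul0r.
Qed.

Lemma qrankE : qrank Q = (n - \dim (singular_radical Q))%N.
Proof.
rewrite /qrank; case: arg_minnP => [|r /quad_in_corank rmin rle].
  by rewrite quad_in_ge ?leq_addl.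
have lt_d : (n - \dim (singular_radical Q) < n.+1)%N by rewrite ltnS leq_subr.
have := rle (Ordinal lt_d) => /=; rewrite quad_in_ge; last by rewrite -leq_subLR.
by move=> /(_ isT) le_r; apply/eqP; rewrite eqn_leq le_r leq_subLR rmin.
Qed.

Lemma even_rank_value_count : ~~ odd (qrank Q) ->
  exists2 eps : int, (eps == 1) || (eps == -1) &
  forall a, #|F|%:Z * #|[set x | Q x == a]|%:Z = #|F|%:Z ^+ n
    + eps * #|F|%:Z ^+ (n - (qrank Q)./2) * (if a == 0 then #|F|%:Z - 1 else -1).
Proof.
rewrite qrankE => even_r; have Q0 := even_corank_singular Qquad even_r.
have radE : radical Q fullv = singular_radical Q.
  apply/eqP; rewrite eqEsubv singular_radical_sub // andbT; apply/subvP => y Ry.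
  by rewrite mem_singular_radical // Ry Q0 ?eqxx.
have dimE : n = (\dim (radical Q fullv) + (n - \dim (singular_radical Q))./2.*2)%N.
  by rewrite even_halfK // radE subnKC // dimvS ?subvf.
have [eps Heps bal] := balanced_even Qquad Q0 dimE.
exists eps => // a; have := bal a.
rewrite /value_count card_vspace PoszX => <-; congr (_ * Posz _).
by apply: eq_card => x; rewrite !inE memvf.
Qed.

End Rank.

(** * Trace forms and their polarisation *)

Section TraceForms.

Variables (F : finFieldType) (L : fieldExtType F).
Local Notation V := (finvect_type L).
Local Notation q := #|F|.
Local Notation m := (\dim {:V}).
Local Notation Gal := ('Gal({:V} / 1%AS))%g.
Implicit Types (x y z : V) (a b : F) (R : {poly V}).

Lemma trace_alg x : (trace x)%:A = galTrace 1%AS {:V}%AS x.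
Proof.
rewrite /trace; case: pickP => [c /eqP // | noc].
have /vlineP[c cE] := mem_galTrace (finField_galois (sub1v {:V}%AS)) (memvf x).
by have := noc c; rewrite cE eqxx.
Qed.

Lemma alg_inj : injective (fun a => a%:A : V).
Proof. exact: (fmorph_inj (in_alg V)). Qed.

Lemma trace_linear a x y : trace (a *: x + y) = a * trace x + trace y.
Proof.
apply: alg_inj; rewrite scalerDl -scalerA !trace_alg raddfD /=; congr (_ + _).
by rewrite /galTrace scaler_sumr; apply: eq_bigr => s _; rewrite linearZ.
Qed.

Lemma traceD x y : trace (x + y) = trace x + trace y.
Proof. by rewrite -[x]scale1r trace_linear mul1r scale1r. Qed.

Lemma trace0 : trace (0 : V) = 0.
Proof. by apply: (addrI (trace (0 : V))); rewrite -traceD !addr0. Qed.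

Lemma traceZ a x : trace (a *: x) = a * trace x.
Proof. by rewrite -[a *: x]addr0 trace_linear trace0 addr0. Qed.

Lemma trace_sum (I : finType) (f : I -> V) : trace (\sum_i f i) = \sum_i trace (f i).
Proof. exact: (big_morph _ traceD trace0). Qed.

(** The trace of [x * z] is the combination of the automorphisms [s], evaluated
    at [x], with coefficients [s z]; these vanish by independence of
    automorphisms. *)
Lemma trace_nondegenerate z : (forall x, trace (x * z) = 0) -> z = 0.
Proof.
move=> tr0.
have := @gal_independent _ _ {:V}%AS [in Gal] (fun s : gal_of _ => s z) _ 1%g (group1 _).
rewrite gal_id; apply=> x _.
under eq_bigr => s _ do rewrite mulrC -rmorphM.
by have := trace_alg (x * z); rewrite tr0 scale0r.
Qed.

Lemma frobenius_aut k :
  exists2 s : gal_of {:V}, s \in Gal & forall x, s x = x ^+ (q ^ k).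
Proof.
have [s gal_s sE] := finField_galois_generator (sub1v {:V}%AS).
elim: k => [|k [t Gt tE]]; first by exists 1%g => [|x]; rewrite ?group1 ?gal_id.
exists (t * s)%g => [|x].
  by rewrite groupM //; have := cycle_id s; rewrite -(eqP gal_s).
by rewrite galM ?memvf // tE sE ?memvf // dimv1 expn1 -exprM -expnSr.
Qed.

Lemma trace_frobenius k x : trace (x ^+ (q ^ k)) = trace x.
Proof.
have [s Gs <-] := frobenius_aut k.
by apply: alg_inj; rewrite !trace_alg galTrace_gal ?memvf.
Qed.

Lemma frobenius_linear k a x y :
  (a *: x + y) ^+ (q ^ k) = a *: x ^+ (q ^ k) + y ^+ (q ^ k).
Proof. by have [s _ sE] := frobenius_aut k; rewrite -!sE linearP. Qed.

Lemma card_ext : #|{: V}| = (q ^ m)%N.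
Proof. by rewrite -card_vspace card_vspacef. Qed.

Lemma expf_card_ext x : x ^+ (q ^ m) = x.
Proof. by rewrite -card_ext expf_card. Qed.

(** Raising the argument of the trace to the power [q ^ (m - k)] moves the
    Frobenius power from [y] to the other factor. *)
Lemma trace_adjoint k x y : (k <= m)%N ->
  trace (x * y ^+ (q ^ k)) = trace (x ^+ (q ^ (m - k)) * y).
Proof.
move=> le_km; rewrite -(trace_frobenius (m - k)) exprMn -exprM -expnD subnKC //.
by rewrite expf_card_ext.
Qed.

Lemma trace_form_quadratic R :
    (forall a x y, R.[a *: x + y] = a *: R.[x] + R.[y]) ->
  quadratic_form (Qform R).
Proof.
move=> Rlin.
have R0 : R.[0] = 0.
  by have := Rlin 1 0 0; rewrite !scale1r addr0 -{1}[R.[0]]addr0 => /addrI <-.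
have RD x y : R.[x + y] = R.[x] + R.[y] by rewrite -[x in LHS]scale1r Rlin scale1r.
have polarE x z : polar (Qform R) x z = trace (x * R.[z] + z * R.[x]).
  rewrite /polar /Qform RD mulrDr !mulrDl !traceD; ring.
split=> [a x|z a x y].
  (* [change] moves the scaling to the field extension structure of [V]. *)
  change (Qform R (a *: x) = a ^+ 2 * Qform R x).
  have -> : Qform R (a *: x) = trace ((a *: x) * (a *: R.[x])).
    by rewrite /Qform -[in R.[_]](addr0 (a *: x)) Rlin R0 addr0.
  by rewrite -scalerAl -scalerAr !traceZ expr2 mulrA.
change (polar (Qform R) (a *: x + y) z = a * polar (Qform R) x z + polar (Qform R) y z).
rewrite !polarE Rlin mulrDl mulrDr -scalerAl -scalerAr -traceZ -traceD.
by congr (trace _); rewrite scalerDr addrACA.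
Qed.

Section SpanFamily.

Variables (s : nat) (l : 'I_s -> nat).

Definition span_poly (c : {ffun 'I_s -> V}) : {poly V} :=
  \sum_(j < s) c j *: 'X^(q ^ l j).

Lemma horner_span_poly c x : (span_poly c).[x] = \sum_(j < s) c j * x ^+ (q ^ l j).
Proof. by rewrite horner_sum; apply: eq_bigr => j _; rewrite !hornerE. Qed.

Lemma span_poly_quadratic c : quadratic_form (Qform (span_poly c)).
Proof.
apply: trace_form_quadratic => a x y; rewrite !horner_span_poly scaler_sumr -big_split /=.
by apply: eq_bigr => j _; rewrite frobenius_linear mulrDr scalerAr.
Qed.

Lemma Qform_span_polyB c d x :
  Qform (span_poly (c - d)) x = Qform (span_poly c) x - Qform (span_poly d) x.
Proof.
have -> : span_poly (c - d) = span_poly c - span_poly d.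
  by rewrite -sumrB; apply: eq_bigr => j _; rewrite !ffunE scalerBl.
by rewrite /Qform hornerD hornerN mulrBr -scaleN1r addrC trace_linear mulN1r addrC.
Qed.

Hypothesis l_incr : forall i j : 'I_s, (i < j)%N -> (l i < l j)%N.
Hypothesis l_ge1 : forall j : 'I_s, (1 <= l j)%N.
Hypothesis l_lt : forall j : 'I_s, (2 * l j < m)%N.

Lemma exponent_inj : injective l.
Proof.
move=> i j lij; apply: val_inj.
by case: (ltngtP i j) => // /l_incr; rewrite lij ltnn.
Qed.

(** The polynomial [P] is [R + R*], with [R] the given polynomial and [R*] its
    adjoint for the trace form. *)
Lemma Qform_span_poly_eq0 c : (forall x, Qform (span_poly c) x = 0) -> c = 0.
Proof.
move=> Qc0.
pose P : {poly V} := span_poly c + \sum_(j < s) c j ^+ (q ^ (m - l j)) *: 'X^(q ^ (m - l j)).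
have Proot x : P.[x] = 0.
  apply: trace_nondegenerate => y; rewrite mulrC.
  have RD : (span_poly c).[y + x] = (span_poly c).[y] + (span_poly c).[x].
    rewrite !horner_span_poly -big_split /=; apply: eq_bigr => j _.
    by rewrite -[y in LHS]scale1r frobenius_linear scale1r mulrDr.
  have := Qc0 (y + x); rewrite {1}/Qform RD mulrDr !mulrDl !traceD.
  rewrite -!/(Qform _ _) !Qc0 add0r addr0 => <-.
  rewrite hornerD mulrDl traceD addrC [y * _]mulrC; congr (_ + _).
  rewrite horner_sum mulr_suml horner_span_poly mulr_sumr !trace_sum.
  apply: eq_bigr => j _; rewrite hornerZ hornerXn mulrA trace_adjoint ?exprMn; last first.
    by have := l_lt j; lia.
  by rewrite [c j ^+ _ * _]mulrC.
have coefP k : P`_k = \sum_(j < s) c j * (k == q ^ l j)%N%:R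
    + \sum_(j < s) c j ^+ (q ^ (m - l j)) * (k == q ^ (m - l j))%N%:R.
  rewrite coefD !coef_sum; congr (_ + _);
    by apply: eq_bigr => j _; rewrite coefZ coefXn.
have q1 : (1 < q)%N := finNzRing_gt1 F.
have sizeP : (size P <= size (enum V))%N.
  rewrite -cardE card_ext; apply/leq_sizeP => k le_k.
  have ltk e : (e < m)%N -> (k == q ^ e)%N = false.
    by rewrite -(ltn_exp2l _ _ q1) => /leq_trans/(_ le_k); rewrite ltn_neqAle eq_sym => /andP[/negPf->].
  rewrite coefP !big1 ?addr0 // => j _; have := l_lt j; have := l_ge1 j => l1 l2.
    by rewrite ltk ?mulr0 //; lia.
  by rewrite ltk ?mulr0 //; lia.
have P0 : P = 0.
  apply: (roots_geq_poly_eq0 _ _ sizeP); last exact: enum_uniq.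
  by apply/allP => x _; apply/eqP/Proot.
apply/ffunP => j; rewrite ffunE.
have := coefP (q ^ l j)%N; rewrite P0 coef0 (bigD1 j) //= eqxx mulr1.
rewrite !big1 ?addr0 => [<- //|i _|i nij]; rewrite eqn_exp2l //.
  by have := l_lt i; have := l_lt j => lj li; rewrite ltn_eqF ?mulr0 //; lia.
by rewrite (inj_eq exponent_inj) eq_sym (negPf nij) mulr0.
Qed.

Lemma codeword_span_poly_inj c d :
  codeword (span_poly c) = codeword (span_poly d) -> c = d.
Proof.
move=> cd; apply/eqP; rewrite -subr_eq0; apply/eqP/Qform_span_poly_eq0 => x.
rewrite Qform_span_polyB; have [->|x0] := eqVneq x 0; first by rewrite /Qform !mul0r subrr.
by have := congr1 (fun f : {ffun _ -> F} => f (Sub x x0)) cd; rewrite !ffunE /= => ->; rewrite subrr.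
Qed.

End SpanFamily.
End TraceForms.

(** * From ranks and types to monomials *)

Section WeightEnumerator.

Variables (F : finFieldType) (L : fieldExtType F).
Local Notation V := (finvect_type L).
Local Notation q := #|F|.
Local Notation m := (\dim {:L}).
Implicit Types (Q : V -> F) (R : {poly V}).

Definition has_type Q (i : nat) := if i == 1%N then type1 Q else type3 Q.

Lemma has_typeE Q i : i \in [:: 1; 2]%N -> has_type Q i = has_sign Q ((-1) ^+ i.+1).
Proof. by rewrite !inE => /orP[]/eqP->; rewrite /has_type /= ?sqrrN ?expr1n. Qed.

Lemma value_count_by_sign Q : quadratic_form Q -> ~~ odd (qrank Q) ->
  exists2 i, i \in [:: 1; 2]%N & forall a, #|[set x | Q x == a]|%:Z =
    q%:Z ^+ m.-1 + (-1) ^+ i.+1 * q%:Z ^+ (m - (qrank Q)./2 - 1)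
      * (if a == 0 then q%:Z - 1 else -1).
Proof.
move=> Qquad even_r; have [eps Heps QN] := even_rank_value_count Qquad even_r.
have m0 : (0 < m)%N := adim_gt0 {:L}.
have le_rm : (qrank Q <= m)%N by rewrite (qrankE Qquad) leq_subr.
have q0 : q%:Z != 0 by rewrite eqz_nat -lt0n ltnW ?finNzRing_gt1.
exists (if eps == 1 then 1 else 2)%N => [|a]; first by case: (eps == 1).
have -> : (-1) ^+ (if eps == 1 then 1 else 2).+1 = eps.
  by case/orP: Heps => /eqP->.
have E1 : q%:Z ^+ m = q%:Z * q%:Z ^+ m.-1 by rewrite -exprS prednK.
have E2 : q%:Z ^+ (m - (qrank Q)./2) = q%:Z * q%:Z ^+ (m - (qrank Q)./2 - 1).
  by rewrite -exprS; congr (_ ^+ _); move: le_rm m0 even_r; lia.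
apply: (mulfI q0); rewrite QN [X in X + _]E1 [X in eps * X]E2.
by rewrite mulrDr !mulrA [q%:Z * eps]mulrC.
Qed.

Lemma has_sign_inj Q (e1 e2 : int) : has_sign Q e1 -> has_sign Q e2 -> e1 = e2.
Proof.
rewrite /has_sign => /andP[_ /eqP->] /andP[_ /eqP/addrI].
have q1 : 1 < q%:Z by rewrite ltz_nat finNzRing_gt1.
have qX_neq0 k : q%:Z ^+ k != 0 by rewrite expf_neq0 // gt_eqF // (lt_trans _ q1).
have q_neq1 : q%:Z - 1 != 0 by rewrite subr_eq0 gt_eqF.
by move/(mulIf (qX_neq0 _))/(mulIf q_neq1).
Qed.

Lemma has_type_unique Q i j : i \in [:: 1; 2]%N -> j \in [:: 1; 2]%N ->
  has_type Q i -> has_type Q j -> i = j.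
Proof.
move=> Hi Hj; rewrite !has_typeE // => /has_sign_inj H /H.
by move: Hi Hj; rewrite !inE => /orP[]/eqP-> /orP[]/eqP->.
Qed.

Lemma exists_type Q : quadratic_form Q -> ~~ odd (qrank Q) ->
  exists2 i, i \in [:: 1; 2]%N & has_type Q i.
Proof.
move=> Qquad even_r; have [i Hi QN] := value_count_by_sign Qquad even_r.
by exists i; rewrite // has_typeE // /has_sign even_r QN eqxx mulrAC eqxx.
Qed.

(** Coordinates are indexed by nonzero vectors, so the zero vector, where the
    form vanishes, has to be taken off. *)
Lemma card_codeword R a : #|[set x | codeword R x == a :> F]| =
  (#|[set x : V | Qform R x == a]| - (a == 0%R))%N.
Proof.
rewrite -(card_imset _ val_inj) /=.
have -> : val @: [set x : {x : V | x != 0} | codeword R x == a] = [set x | Qform R x == a] :\ 0.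
  apply/setP => x; rewrite !inE; apply/imsetP/andP => [[y]|[x0 Qx]].
    by rewrite inE ffunE => Qy ->; split=> //; exact: (valP y).
  by exists (Sub x x0); rewrite // inE ffunE.
rewrite [in RHS](cardsD1 0) inE {2}/Qform mul0r trace0 eq_sym.
by rewrite addKn.
Qed.

Section Monomials.

Variables (p : nat) (omega : 'I_p -> F) (i0 : 'I_p).
Hypothesis omega_inj : injective omega.
Hypothesis omega0 : omega i0 = 0.

Definition weight_monomial (c : {ffun {x : V | x != 0} -> F}) : {mpoly int[p]} :=
  \prod_(j < p) 'X_j ^+ #|[set x | c x == omega j]|.

Definition type_monomial (r i : nat) : {mpoly int[p]} :=
  'X_i0 ^+ absz (exp_a q m r i) * (\prod_(j < p | j != i0) 'X_j ^+ absz (exp_b q m r i)).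

Lemma weight_monomialE R a b :
    #|[set x : V | Qform R x == 0]| = a.+1 ->
    (forall c, c != 0 -> #|[set x : V | Qform R x == c]| = b) ->
  weight_monomial (codeword R) = 'X_i0 ^+ a * \prod_(j < p | j != i0) 'X_j ^+ b.
Proof.
move=> aE bE; rewrite /weight_monomial (bigD1 i0) //= card_codeword omega0 aE eqxx subn1.
congr (_ * _); apply: eq_bigr => j nj; rewrite card_codeword.
have nz : omega j != 0 by rewrite -omega0 (inj_eq omega_inj).
by rewrite bE // (negPf nz) subn0.
Qed.

Lemma weight_monomial0 : weight_monomial (codeword 0) = 'X_i0 ^+ (q ^ m - 1).
Proof.
rewrite (@weight_monomialE 0 (q ^ m - 1) 0).
- by rewrite big1 ?mulr1 // => j _; rewrite expr0.
- rewrite -addn1 subnK ?expn_gt0 ?(ltnW (finNzRing_gt1 F)) //.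
  by rewrite -card_ext; apply: eq_card => x; rewrite inE /Qform horner0 mulr0 trace0 eqxx.
- move=> c c0; apply: eq_card0 => x; rewrite inE /Qform horner0 mulr0 trace0.
  by rewrite eq_sym (negPf c0).
Qed.

Lemma weight_monomial_typed R i : quadratic_form (Qform R) ->
    i \in [:: 1; 2]%N -> ~~ odd (qrank (Qform R)) -> has_type (Qform R) i ->
  weight_monomial (codeword R) = type_monomial (qrank (Qform R)) i.
Proof.
move=> Rquad Hi even_r Ri; have [i' Hi' QN] := value_count_by_sign Rquad even_r.
have ii' : i = i'.
  apply: (has_type_unique Hi Hi' Ri); rewrite has_typeE // /has_sign even_r QN eqxx.
  by rewrite mulrAC eqxx.
subst i'; rewrite /type_monomial; apply: weight_monomialE => [|c c0].
  have : (0 < #|[set x | Qform R x == 0%R]|)%N.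
    by apply/card_gt0P; exists 0; rewrite inE /Qform mul0r trace0.
  have : #|[set x | Qform R x == 0]|%:Z = exp_a q m (qrank (Qform R)) i + 1.
    by rewrite QN eqxx /exp_a subrK mulrAC.
  by move: #|_| (exp_a _ _ _ _) => n a; lia.
have := QN c; rewrite (negPf c0) => E; rewrite /exp_b.
suff <- : #|[set x | Qform R x == c]|%:Z =
    q%:Z ^+ m.-1 + (-1) ^+ i * q%:Z ^+ (m - (qrank (Qform R))./2 - 1) by [].
by rewrite E exprS mulrN1 mulN1r mulNr opprK.
Qed.

End Monomials.

Lemma big_fset_filter (M : nmodType) (S : {fset {poly V}}) (P : pred {poly V}) (G : M) :
  \sum_(R <- S | P R) G = G *+ #|` [fset R in S | P R]%fset|.
Proof.
rewrite -big_filter big_const_seq count_predT iter_addr_0; congr (_ *+ _).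
apply: perm_size; apply: uniq_perm; rewrite ?filter_uniq ?fset_uniq // => R.
by rewrite mem_filter !inE andbC.
Qed.

(** Each nonzero [R] is counted by [Mcount] only for [r] equal to its own
    rank, so exchanging the sums leaves a sum over the types of [R]. *)
Lemma sum_by_type (M : nmodType) (S : {fset {poly V}}) (G : nat -> nat -> M) :
  \sum_(1 <= i < 3) \sum_(r <- rank_set S) G r i *+ Mcount S r i =
  \sum_(R <- S | R != 0) \sum_(i <- [:: 1; 2]%N | has_type (Qform R) i) G (qrank (Qform R)) i.
Proof.
rewrite [RHS](exchange_big_dep predT) //= -[index_iota 1 3]/[:: 1; 2]%N.
apply: eq_bigr => i _.
under eq_bigr => r _ do rewrite -big_fset_filter.
rewrite (exchange_big_dep (fun R => (R != 0) && has_type (Qform R) i)) /=; last first.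
  by move=> r R _ /and3P[-> _ Ri]; exact: Ri.
rewrite big_seq_cond [RHS]big_seq_cond; apply: eq_bigr => R /andP[SR /andP[R0 Ri]].
rewrite (big_rem (qrank (Qform R))) /=; last by apply/imfsetP; exists R.
rewrite R0 eqxx -/(has_type _ _) Ri /= big_seq_cond big1 ?addr0 // => r /andP[].
by rewrite mem_rem_uniq ?fset_uniq // inE eq_sym => /andP[/negPf->].
Qed.

End WeightEnumerator.

(* The exponents are nonnegative whenever the coefficient [Mcount] is nonzero;
   [absz] turns them into elements of [nat]. *)
Theorem proposition3p7 (q m : nat) (F : finFieldType) (L : fieldExtType F)
    (hq : #|F| = q) (hm : \dim {:L} = m)
    (s : nat) (l : 'I_s -> nat)
    (l_incr : forall i j : 'I_s, (i < j)%N -> (l i < l j)%N)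
    (l_ge1 : forall j : 'I_s, (1 <= l j)%N)
    (l_lt : forall j : 'I_s, (2 * l j < m)%N)
    (omega : 'I_q -> F) (omega_bij : bijective omega)
    (i0 : 'I_q) (hi0 : i0 = 0%N :> nat) (omega0 : omega i0 = 0)
    (heven : even_rank_family (span_family L l)) :
  complete_weight_enumerator omega (code (span_family L l)) =
    'X_i0 ^+ (q ^ m - 1)
    + \sum_(1 <= i < 3) \sum_(r <- rank_set (span_family L l))
        'X_i0 ^+ absz (exp_a q m r i)
        * (\prod_(j < q | j != i0) 'X_j ^+ absz (exp_b q m r i))
        *+ Mcount (span_family L l) r i.
Proof.
have {hi0} omega_inj := bij_inj omega_bij.
set S := span_family L l in heven *.
have SP R : reflect (exists c, R = span_poly l c) (R \in S).
  by apply: (iffP (imfsetP _ _ _ _)) => [[c _ ->]|[c ->]]; exists c.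
have Squad R : R \in S -> quadratic_form (Qform R).
  by case/SP => c ->; exact: span_poly_quadratic.
have S0 : 0 \in S.
  by apply/SP; exists 0; rewrite /span_poly big1 // => j _; rewrite ffunE scale0r.
have code_inj : {in S &, injective (@codeword F L)}.
  move=> R R' /SP[c ->] /SP[d ->] /codeword_span_poly_inj-> //.
  by move=> j; rewrite hm.
subst q m.
have -> : complete_weight_enumerator omega (code S) =
    \sum_(R <- S) weight_monomial omega (codeword R).
  have uniq_code : uniq [seq codeword R | R <- S] by rewrite map_inj_in_uniq ?fset_uniq.
  rewrite -(big_map _ predT (weight_monomial omega)) big_uniq //=.
  by apply: eq_bigl => c; rewrite inE.
rewrite (bigD1_seq (0 : {poly finvect_type L})) ?fset_uniq //= (weight_monomial0 _ omega_inj omega0).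
congr (_ + _); rewrite (sum_by_type S (type_monomial L i0)).
rewrite big_seq_cond [RHS]big_seq_cond; apply: eq_bigr => R /andP[SR R0].
have [i Hi Ri] := exists_type (Squad R SR) (heven _ SR).
rewrite (weight_monomial_typed omega_inj omega0 (Squad R SR) Hi (heven _ SR) Ri).
rewrite big_mkcond (bigD1_seq i) //= Ri big1_seq ?addr0 // => j /andP[nji Hj].
case: ifP => // /(has_type_unique Hi Hj Ri) ij.
by rewrite ij eqxx in nji.
Qed.
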